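(* Let $(T,X)$ be an individually distal semiflow on a compact Hausdorff space $X$. If $(\langle T\rangle,X)$ is minimal, then $(T,X)$ is minimal.
   Context: $X$ is a nonempty compact Hausdorff space and $T$ is a discrete infinite semigroup with identity $e$. A semiflow $(T,X)$ is a continuous map $T\times X\to X$, $(t,x)\mapsto tx$, with $ex=x$ and $t(sx)=(ts)x$. $(T,X)$ is individually distal if for each $t\in T$ the cascade $(t,X)$ (the $\mathbb Z_+$-action $(n,x)\mapsto t^nx$) is distal, i.e. for all $x\neq y$ in $X$ there is an entourage $\alpha$ of the compatible uniformity of $X$ with $(t^nx,t^ny)\notin\alpha$ for all $n\ge0$. An individually distal semiflow is invertible (each $x\mapsto tx$ is a homeomorphism of $X$), and $\langle T\rangle$ denotes the group of self-homeomorphisms of $X$ generated by $T$, acting on $X$. A (semi)flow $(S,X)$ is minimal if $Sx$ is dense in $X$ for every $x\in X$. *)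

(* Defs.v *)
From mathcomp Require Export all_boot all_classical topology.

Set Implicit Arguments.
Unset Strict Implicit.
Unset Printing Implicit Defensive.

Local Open Scope classical_set_scope.

Record semiflow (T : monoidType) (X : topologicalType) (act : T -> X -> X) :
    Prop := {
  semiflow_continuous :
    continuous (fun p : discrete_topology T * X => act p.1 p.2);
  semiflow_one : forall x, act 1%g x = x;
  semiflow_mul : forall t s x, act t (act s x) = act (t * s)%g x }.

(* On a compact Hausdorff space the compatible uniformity is unique, so that
   the one carried by X is the one meant in the compact Hausdorff case. *)
Definition distal (S : Type) (X : uniformType) (a : S -> X -> X) : Prop :=
  forall x y : X, x <> y ->
    exists2 alpha : set (X * X), entourage alpha &
      forall s : S, ~ alpha (a s x, a s y).

Definition cascade (T : monoidType) (X : Type) (act : T -> X -> X) (t : T) :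
  nat -> X -> X := fun n x => act (t ^+ n)%g x.

Definition individually_distal (T : monoidType) (X : uniformType)
  (act : T -> X -> X) : Prop := forall t : T, distal (cascade act t).

Definition homeomorphism (X : topologicalType) (f : X -> X) : Prop :=
  continuous f /\
  exists g : X -> X, [/\ continuous g, cancel f g & cancel g f].

Definition homeomorphism_group (X : topologicalType) (H : set (X -> X)) :
    Prop :=
  [/\ forall f, H f -> homeomorphism f,
      H id,
      forall f g, H f -> H g -> H (f \o g) &
      forall f g, H f -> cancel f g -> cancel g f -> H g].

(* The intersection ranges over no group at all, hence gives every self-map,
   when some act t is not a homeomorphism; individual distality excludes
   this. *)
Definition generated_group (T : Type) (X : topologicalType)
  (act : T -> X -> X) : set (X -> X) :=
  smallest (@homeomorphism_group X) (range act).

Definition minimal (I : Type) (X : topologicalType) (S : set I)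
  (a : I -> X -> X) : Prop := forall x : X, dense [set a s x | s in S].

(* Main.v *)
(* A distal continuous self-map f of a compact Hausdorff space is pointwise
   recurrent: the closure E of its positive iterates in X^X is a compact right
   topological semigroup, so it has an idempotent u (Ellis-Numakura); the points
   x and u x have the same image under u, so they are proximal and u x = x.
   Hence the identity lies in E and x lies in the closure of {f x, f^2 x, ...}.
   It follows that each act t is a homeomorphism, and that a closed set M with
   act t M <= M also satisfies (act t)^-1 M <= M.  The closure of a T-orbit is
   therefore invariant under the group generated by T, hence is all of X. *)
Require Import Defs.

Set Implicit Arguments.
Unset Strict Implicit.
Unset Printing Implicit Defensive.

Local Open Scope classical_set_scope.

Definition closed_subsemigroup (S : topologicalType) (mul : S -> S -> S)
    (A : set S) : Prop :=
  [/\ closed A, A !=set0 & forall p q, A p -> A q -> A (mul p q)].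

(** Zorn's lemma for unions is applied to complements: a maximal [U] with [E \ U] a closed
    subsemigroup leaves a minimal one. The empty chain is bounded by [set0], that is, by [E]
    itself. *)
Lemma minimal_closed_subsemigroup (S : topologicalType) (mul : S -> S -> S)
    (E : set S) : compact E -> closed_subsemigroup mul E ->
  exists A, [/\ A `<=` E, closed_subsemigroup mul A &
    forall B, B `<=` A -> closed_subsemigroup mul B -> A `<=` B].
Proof.
move=> cE sgE.
pose P := [set U : set S | closed_subsemigroup mul (E `\` U)].
have [F FP Ftot|U [PU Umax]] := @Zorn_bigcup S P; last first.
  exists (E `\` U); split => // B BA sgB x Ax.
  apply: contrapT => nBx; apply: (Umax (~` B)).
    split; last by move=> /(_ x nBx) Ux; case: Ax.
    by move=> y Uy By; have [_] := BA y By.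
  rewrite /P /= setDE setCK; suff -> : E `&` B = B by [].
  by apply: setIidr => y /BA[].
have [->|/set0P F0] := eqVneq F set0; first by rewrite bigcup_set0 /P /= setD0.
(* The nested nonempty sets [E \ V] form a filter base; being closed, they all contain any cluster
   point, which compactness of [E] supplies. *)
have PF : ProperFilter (filter_from F (fun V => E `\` V)).
  apply: filter_from_proper; last by move=> V /FP[].
  apply: filter_from_filter => // V W FV FW.
  case: (Ftot _ _ FV FW) => sub; [exists W | exists V] => // y [Ey ny].
    by split; split => // /sub.
  by split; split => // /sub.
have [V0 FV0] := F0.
have [|x [Ex clx]] := cE _ PF; first by exists V0 => //; exact: subDsetl.
have ED : E `\` \bigcup_(V in F) V = \bigcap_(V in F) (E `\` V).
  rewrite eqEsubset; split=> [y [Ey ny] V FV|y Hy].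
    by split=> // Vy; apply: ny; exists V.
  by split=> [|[V FV Vy]]; [case: (Hy _ FV0)|case: (Hy V FV)].
rewrite /P /= ED; split.
- by apply: closed_bigI => V /FP[].
- exists x => V FV; have [clV _ _] := FP V FV; apply: clV => N Nx.
  by apply: clx => //; exists V.
- move=> p q Ep Eq V FV; have [_ _ mulV] := FP V FV.
  by apply: mulV; [exact: Ep|exact: Eq].
Qed.

(** For [u] in a minimal [A], the left ideal [A u] is again a closed subsemigroup, so [A u = A] and
    some [v] in [A] has [v u = u]. The set of such [v] is then itself a closed subsemigroup, hence
    all of [A], and contains [u]. *)
Lemma ellis_numakura (S : topologicalType) (mul : S -> S -> S) (E : set S) :
  hausdorff_space S -> associative mul -> (forall q, continuous (mul^~ q)) ->
  compact E -> closed_subsemigroup mul E -> exists2 u, E u & mul u u = u.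
Proof.
move=> hS mulA cmul cE sgE.
have [A [AE [clA [u Au] mulAA] Amin]] := minimal_closed_subsemigroup cE sgE.
have AuA : A `<=` (mul^~ u) @` A.
  apply: Amin; first by move=> _ [p Ap <-]; exact: mulAA.
  split; first 1 last.
  - by exists (mul u u), u.
  - move=> _ _ [p Ap <-] [q Aq <-]; exists (mul (mul p u) q).
      exact: (mulAA _ _ (mulAA _ _ Ap Au)).
    by rewrite !mulA.
  - apply: compact_closed => //; apply: continuous_compact.
      exact: continuous_subspaceT.
    exact: subclosed_compact cE AE.
have [v Av vu] := AuA u Au.
exists u; first exact: AE.
suff /(_ u Au)[] : A `<=` A `&` (mul^~ u) @^-1` [set u] by [].
apply: Amin; first exact: subIsetl.
split; first 1 last.
- by exists v.
- move=> p q [Ap pu] [Aq qu]; split; first exact: mulAA.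
  by rewrite /= -mulA qu.
- apply: closedI => //; apply: preimage_closed; first by move=> ? _; exact: cmul.
  exact/accessible_closed_set1/hausdorff_accessible.
Qed.

Lemma ptws_continuous (Y X : topologicalType) (I : choiceType)
    (f : Y -> {ptws I -> X}) :
  (forall i, continuous (fun y => f y i)) -> continuous f.
Proof.
move=> cf y; apply/cvg_sup => i.
by apply: continuous_comp_initial; exact: cf.
Qed.

Lemma ptws_eval_continuous (X : topologicalType) (I : choiceType) (i : I) :
  continuous (fun f : {ptws I -> X} => f i).
Proof. exact: (@proj_continuous I (fun=> X) i). Qed.

(** Composition is not jointly continuous, so the two closures are crossed one at a time: [p \o q]
    is continuous in [p] for every [q], but in [q] only when [p] is continuous. Hence [p] is reduced
    to an iterate first. *)
Lemma closure_iterates_subsemigroup (X : topologicalType) (f : X -> X) :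
  continuous f ->
  closed_subsemigroup (fun p q : {ptws X -> X} => p \o q)
    (closure [set (iter n.+1 f : {ptws X -> X}) | n in [set: nat]]).
Proof.
move=> cf; set A := [set _ | _ in _]; split; first exact: closed_closure.
  by exists (iter 1 f); apply: subset_closure; exists 0.
have citer n : continuous (iter n f).
  elim: n => [x|n IH x]; first exact: cvg_id.
  exact: (@continuous_comp _ _ _ (iter n f) f x (IH x) (cf _)).
have closed_absorbs (h : {ptws X -> X} -> {ptws X -> X}) :
    continuous h -> (forall p, A p -> closure A (h p)) ->
    forall p, closure A p -> closure A (h p).
  move=> ch Ah; change (closure A `<=` h @^-1` closure A).
  rewrite [X in X `<=` _]closureE; apply: smallest_sub => //.
  apply: preimage_closed; first by move=> ? _; exact: ch.
  exact: closed_closure.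
move=> p q Ep Eq.
apply: (closed_absorbs (fun p => p \o q)) => //.
  by apply: ptws_continuous => x; exact: ptws_eval_continuous.
move=> _ [n _ <-].
apply: (closed_absorbs (fun q => iter n.+1 f \o q)) => //.
  apply: ptws_continuous => x g.
  apply: (@continuous_comp _ _ _ (fun q : {ptws X -> X} => q x) (iter n.+1 f)).
    exact: ptws_eval_continuous.
  exact: citer.
move=> _ [m _ <-]; apply: subset_closure; exists (n + m.+1) => //.
by apply/funext => x /=; rewrite -iterS -addSn iterD.
Qed.

Section distal_map.
Variables (X : uniformType) (f : X -> X).
Hypotheses (cptX : compact [set: X]) (hausX : hausdorff_space X).
Hypotheses (cf : continuous f) (distf : distal (fun n => iter n f)).

(** Counting from [n.+1] matters: with [iter 0 f] allowed, the claim would be trivial. *)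
Lemma distal_pointwise_recurrent (x : X) :
  closure [set iter n.+1 f x | n in [set: nat]] x.
Proof.
set A := [set (iter n.+1 f : {ptws X -> X}) | n in [set: nat]].
have hE : hausdorff_space {ptws X -> X} by exact: hausdorff_product.
have cE : compact (closure A).
  apply: (subclosed_compact _ (B := [set: {ptws X -> X}])) => //.
    exact: closed_closure.
  suff -> : [set: {ptws X -> X}] = [set g | forall i, [set: X] (g i)].
    exact: (@tychonoff X (fun=> X) (fun=> [set: X])).
  by rewrite eqEsubset.
have [//|q|//||u Eu uu] :=
    @ellis_numakura {ptws X -> X} (fun p q => p \o q) (closure A) hE.
  by apply: ptws_continuous => y; exact: ptws_eval_continuous.
  exact: closure_iterates_subsemigroup.
have u_id y : u y = y.
  apply: contrapT => /distf[a enta na].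
  have uuy : u (u y) = u y by rewrite -[LHS]/((u \o u) y) uu.
  have Fu : Filter (nbhs (u : {ptws X -> X})) := nbhs_filter _.
  (* Since [u] agrees at [y] and [u y], an iterate close to [u] at both points brings their images
     within [a], each being half of [a] away from [u y]. *)
  have near_u z b : entourage b ->
      \forall g \near (u : {ptws X -> X}), b (u z, g z).
    move=> /(nbhs_entourage (u z)) /(ptws_eval_continuous (i := z) (x := u)).
    by apply: (filterS (Filter := Fu)) => g /xsectionP.
  have Ny := near_u y _ (entourage_split_ent enta).
  have Nuy := near_u (u y) _ (entourage_inv (entourage_split_ent enta)).
  rewrite uuy in Nuy.
  have [_ [[n _ <-] [n1 n2]]] := Eu _ (filterI (Filter := Fu) Nuy Ny).
  by apply: (na n.+1); exact: entourage_split n1 n2.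
rewrite -[in X in closure _ X](u_id x) => N Nux.
have [_ [[n _ <-] Nn]] := Eu _ (ptws_eval_continuous (i := x) (x := u) Nux).
by exists (iter n.+1 f x); split => //; exists n.
Qed.

Lemma distal_preimage_closed (M : set X) : closed M -> f @` M `<=` M ->
  f @^-1` M `<=` M.
Proof.
move=> clM fM x Mfx; apply: clM.
move: (@distal_pointwise_recurrent x); apply: closureS => _ [n _ <-].
by elim: n => //= n IH; apply: fM; exists (iter n.+1 f x).
Qed.

(** Distality at time 1 gives injectivity. The range is closed and contains all positive iterates of
    [x], so by recurrence it contains [x]. The inverse is continuous because [f] is a closed map. *)
Lemma distal_homeomorphism : homeomorphism f.
Proof.
have clf M : closed M -> closed (f @` M).
  move=> clM; apply: compact_closed => //; apply: continuous_compact.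
    exact: continuous_subspaceT.
  exact: subclosed_compact clM cptX _.
have injf : injective f.
  move=> x y fxy; apply: contrapT => /distf[a enta na]; apply: (na 1).
  by rewrite /= fxy; exact: entourage_refl.
have surjf x : exists y, f y = x.
  suff [y _ <-] : range f x by exists y.
  apply: (clf _ (@closedT _)).
  move: (@distal_pointwise_recurrent x); apply: closureS => _ [n _ <-].
  by exists (iter n f x).
have [g fg] := choice surjf.
have gf : cancel f g by move=> x; apply: injf.
split=> //; exists g; split => //; apply/continuous_closedP => M clM.
suff -> : g @^-1` M = f @` M by exact: clf.
rewrite eqEsubset; split=> [x Mgx|_ [x Mx <-]]; first by exists (g x).
by rewrite /= gf.
Qed.

End distal_map.

(** Equality, unlike inclusion, passes to inverses; this bounds the generated group from above. *)
Lemma invariant_homeomorphism_group (X : topologicalType) (M : set X) :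
  homeomorphism_group [set h | homeomorphism h /\ h @^-1` M = M].
Proof.
split=> [f []//| |f g [[cf [f' [cf' ff' f'f]]] fM] [[cg [g' [cg' gg' g'g]]] gM]|
  f g [[cf [f' [cf' ff' f'f]]] fM] fg gf].
- by split=> //; split=> [x|]; [|exists id; split=> // x]; exact: cvg_id.
- split; last by rewrite comp_preimage fM gM.
  split; first by move=> x; apply: continuous_comp; [exact: cg|exact: cf].
  exists (g' \o f'); split; [|exact: can_comp|exact: can_comp].
  by move=> x; apply: continuous_comp; [exact: cf'|exact: cg'].
- have <- : f' = g by apply/funext => x; rewrite -[RHS]ff' gf.
  split; first by split=> //; exists f.
  by rewrite -[in LHS]fM -comp_preimage (_ : f \o f' = id) //; exact/funext.
Qed.

Lemma semiflow_map_continuous (T : monoidType) (X : topologicalType)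
    (act : T -> X -> X) (t : T) : semiflow act -> continuous (act t).
Proof.
move=> flow x.
apply: (@continuous_comp _ _ _ (fun y => (t : discrete_topology T, y))
  (fun p => act p.1 p.2)); last exact: (semiflow_continuous flow).
apply: (@cvg_pair X (discrete_topology T) X (nbhs x)
  (nbhs (t : discrete_topology T)) (nbhs x)); last exact: cvg_id.
exact: cvg_cst.
Qed.

Theorem corollary1p23 (T : monoidType) (X : uniformType) (act : T -> X -> X)
    (infT : infinite_set [set: T])
    (X0 : [set: X] !=set0) (cptX : compact [set: X])
    (hausX : hausdorff_space X)
    (flow : semiflow act) (dist : individually_distal act)
    (minG : minimal (generated_group act) (fun g x => g x)) :
  minimal [set: T] act.
Proof.
move=> x; set O := [set act s x | s in [set: T]].
have cact t : continuous (act t) by exact: semiflow_map_continuous.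
have iterE t n y : iter n (act t) y = act (t ^+ n)%g y.
  elim: n => [|n /= ->]; first by rewrite semiflow_one.
  by rewrite semiflow_mul // expgS.
have distt t : distal (fun n => iter n (act t)).
  move=> y z /(dist t)[a enta na]; exists a => // n; rewrite !iterE; exact: na.
have invO t : act t @` closure O `<=` closure O.
  move=> _ [y Oy <-] N /cact /Oy[_ [[s _ <-] Ns]].
  by exists (act t (act s x)); split => //; exists (t * s)%g; rewrite // semiflow_mul.
have sub : generated_group act `<=`
    [set h | homeomorphism h /\ h @^-1` closure O = closure O].
  apply: smallest_sub; first exact: invariant_homeomorphism_group.
  move=> _ [t _ <-]; split; first exact: distal_homeomorphism.
  rewrite eqEsubset; split; last by move=> y Oy; apply: invO; exists y.
  by apply: distal_preimage_closed => //; exact: closed_closure.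
have Ox : closure O x.
  by apply: subset_closure; exists 1%g; rewrite // semiflow_one.
move=> U [y Uy] oU.
have [_ [/[swap] [[g Gg <-]] Ugx]] := minG x U (ex_intro _ y Uy) oU.
have [_ gO] := sub g Gg.
have : closure O (g x) by rewrite -[closure O _]/((g @^-1` closure O) x) gO.
move=> /(_ U) [|z [Oz Uz]]; first exact: open_nbhs_nbhs.
by exists z.
Qed.
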